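(* Let $p\ge 2$ and consider the model $Y=B_0+\mathbf W^\top\mathbf B$ with $\mathbf W=(W_1,\dots,W_{p-1})^\top$, where $\mathbf A=(B_0,\mathbf B^\top)^\top$ is independent of $\mathbf W$ and has finite second moments. Suppose that the support of $\mathbf W$ contains the Cartesian product of three (distinct) points in each coordinate, that is, there are sets $T_1,\dots,T_{p-1}\subset\mathbb R$ with $|T_j|=3$ and $T_1\times\cdots\times T_{p-1}\subseteq \operatorname{supp}(\mathbf W)$. Then there exist $p(p+1)/2$ points $\mathbf w_1,\dots,\mathbf w_{p(p+1)/2}$ in the support of $\mathbf W$ such that the $\frac{p(p+1)}2\times\frac{p(p+1)}2$ matrix $$S=\Big[\operatorname{v}\big((1,\mathbf w_1^\top)^\top\big),\dots,\operatorname{v}\big((1,\mathbf w_{p(p+1)/2}^\top)^\top\big)\Big]^\top$$ has full rank $p(p+1)/2$, and consequently the means and the variances and covariances of the random coefficients $\mathbf A$ (i.e. $\mu^*$ and $\Sigma^*$) are identified. Conversely, if there is a $j\in\{1,\dots,p-1\}$ such that $W_j$ has only two support points, then identification fails in the class of full-rank covariance matrices.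
   Context: $\mu^*=\mathbb E[\mathbf A]\in\mathbb R^p$ and $\Sigma^*=\operatorname{Cov}(\mathbf A)\in\mathbb R^{p\times p}$. The support $\operatorname{supp}(\mathbf W)$ is the smallest closed set of probability one under the law of $\mathbf W$ (similarly for $W_j$). By independence, for $\mathbf w\in\operatorname{supp}(\mathbf W)$, $\mathbb E[Y\mid\mathbf W=\mathbf w]=(1,\mathbf w^\top)\mu^*$ and $\operatorname{Var}(Y\mid\mathbf W=\mathbf w)=(1,\mathbf w^\top)\Sigma^*(1,\mathbf w^\top)^\top$. For $\mathbf x\in\mathbb R^p$, $$\operatorname{v}(\mathbf x)=(x_1^2,\dots,x_p^2,\,2x_1x_2,\dots,2x_1x_p,\,2x_2x_3,\dots,2x_2x_p,\dots,2x_{p-1}x_p)^\top\in\mathbb R^{p(p+1)/2}.$$ Identification (from the first two conditional moments of the response given the covariates), with the law of $\mathbf W$ fixed: $\mu^*$ and $\Sigma^*$ are identified if, whenever two random coefficient vectors $\mathbf A,\mathbf A'$ with finite second moments and independent of $\mathbf W$ give the same $\mathbb E[Y\mid\mathbf W=\mathbf w]$ and $\operatorname{Var}(Y\mid\mathbf W=\mathbf w)$ for all $\mathbf w\in\operatorname{supp}(\mathbf W)$, then they have the same mean vector and the same covariance matrix. Identification in the class of full-rank covariance matrices is the same notion with both $\mathbf A$ and $\mathbf A'$ restricted to have positive definite covariance matrices. *)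

(* Defs.v *)
From HB Require Import structures.
From mathcomp Require Import all_boot all_order all_algebra.
From mathcomp Require Import all_classical all_reals all_analysis.

Set Implicit Arguments.
Unset Strict Implicit.
Unset Printing Implicit Defensive.

Import Order.TTheory GRing.Theory Num.Theory.
Import numFieldNormedType.Exports.

Local Open Scope classical_set_scope.
Local Open Scope ring_scope.

Notation borel_rV R n := (g_sigma_algebraType (@open 'rV[R]_n)).

Definition independent_RV d d1 d2 (T : measurableType d)
    (T1 : measurableType d1) (T2 : measurableType d2) (R : realType)
    (P : probability T R) (X : {RV P >-> T1}) (Y : {RV P >-> T2}) : Prop :=
  forall (B : set T1) (C : set T2), measurable B -> measurable C ->
    P (X @^-1` B `&` Y @^-1` C) = (P (X @^-1` B) * P (Y @^-1` C))%E.

(* The smallest closed set of probability one under the law of X. *)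
Definition supp d (T : measurableType d) (R : realType) (P : probability T R)
    (V : topologicalType) (X : T -> V) : set V :=
  smallest [set C | closed C /\ P (X @^-1` C) = 1%E] set0.

(* g is the version of w |-> E[Z | W = w] that is continuous on supp(W); any two
   such g agree at every point of supp(W).  The averaging identity is tested on
   bounded Borel sets only, because W is not assumed to have any moment, so that
   Z itself may fail to be integrable. *)
Definition is_cond_mean d (T : measurableType d) (R : realType)
    (P : probability T R) (n : nat) (W : T -> 'rV[R]_n) (Z : T -> R)
    (g : 'rV[R]_n -> R) : Prop :=
  [/\ measurable_fun [set: borel_rV R n] (g : borel_rV R n -> R),
      {within supp P W, continuous g} &
      forall B : set 'rV[R]_n,
        measurable (B : set (borel_rV R n)) -> bounded_set B ->
        [/\ P.-integrable (W @^-1` B) (EFin \o Z),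
            P.-integrable (W @^-1` B) (EFin \o (g \o W)) &
            (\int[P]_(t in W @^-1` B) (Z t)%:E =
             \int[P]_(t in W @^-1` B) (g (W t))%:E)%E]].

Definition cond_mean d (T : measurableType d) (R : realType)
    (P : probability T R) (n : nat) (W : T -> 'rV[R]_n) (Z : T -> R) :
    'rV[R]_n -> R :=
  xget (fun=> 0) [set g | is_cond_mean P W Z g].

Definition cond_var d (T : measurableType d) (R : realType)
    (P : probability T R) (n : nat) (W : T -> 'rV[R]_n) (Z : T -> R) :
    'rV[R]_n -> R :=
  cond_mean P W (fun t => (Z t - cond_mean P W Z (W t)) ^+ 2).

(* Here n = p - 1 is the number of covariates.  Entry 0 of rc_A is the random
   intercept B_0, and entry j + 1 is the random slope of the j-th covariate. *)
Record rc_model (R : realType) (n : nat) := RCModel {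
  rc_d : measure_display;
  rc_T : measurableType rc_d;
  rc_P : probability rc_T R;
  rc_W : {RV rc_P >-> borel_rV R n};
  rc_A : {RV rc_P >-> borel_rV R n.+1};
  rc_second_moments : forall i : 'I_n.+1,
    (fun t => (rc_A t : 'rV[R]_n.+1) 0 i) \in Lfun rc_P 2%:E;
  rc_independent : independent_RV rc_A rc_W }.

Section RCModel.
Context (R : realType) (n : nat).
Implicit Type M : rc_model R n.

Definition covariates M (t : rc_T M) : 'rV[R]_n := rc_W M t.

Definition coefficients M (t : rc_T M) : 'rV[R]_n.+1 := rc_A M t.

Definition response M (t : rc_T M) : R :=
  coefficients t 0 ord0 +
  \sum_(j < n) covariates t 0 j * coefficients t 0 (lift ord0 j).

Definition suppW M : set 'rV[R]_n := supp (rc_P M) (@covariates M).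

Definition suppWj M (j : 'I_n) : set R :=
  supp (rc_P M) (fun t => @covariates M t 0 j).

Definition mean_vec M : 'rV[R]_n.+1 :=
  \row_i fine (expectation (rc_P M) (fun t => @coefficients M t 0 i)).

Definition cov_mx M : 'M[R]_n.+1 :=
  \matrix_(i, j) fine (covariance (rc_P M)
    (fun t => @coefficients M t 0 i) (fun t => @coefficients M t 0 j)).

Definition same_covariate_law M M' : Prop :=
  forall B : set (borel_rV R n), measurable B ->
    distribution (rc_P M) (rc_W M) B = distribution (rc_P M') (rc_W M') B.

(* Identification from the first two conditional moments, the law of W being
   that of M0 and the random coefficients ranging over the class C.  The two
   competing models may live on different probability spaces. *)
Definition identified_in (C : rc_model R n -> Prop) (M0 : rc_model R n) : Prop :=
  forall M M' : rc_model R n,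
    same_covariate_law M M0 -> same_covariate_law M' M0 -> C M -> C M' ->
    (forall w, suppW M0 w ->
      cond_mean (rc_P M) (@covariates M) (@response M) w =
        cond_mean (rc_P M') (@covariates M') (@response M') w /\
      cond_var (rc_P M) (@covariates M) (@response M) w =
        cond_var (rc_P M') (@covariates M') (@response M') w) ->
    mean_vec M = mean_vec M' /\ cov_mx M = cov_mx M'.

Definition identified : rc_model R n -> Prop := identified_in (fun=> True).

Definition posdef (p : nat) (S : 'M[R]_p) : Prop :=
  S^T = S /\ forall x : 'rV[R]_p, x != 0 -> 0 < (x *m S *m x^T) 0 0.

Definition identified_full_rank : rc_model R n -> Prop :=
  identified_in (fun M => posdef (cov_mx M)).

End RCModel.

Section HalfVectorization.
Context (R : realType).

Definition vech_seq (p : nat) (x : 'rV[R]_p) : seq R :=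
  [seq x 0 i ^+ 2 | i <- enum 'I_p] ++
  [seq 2 * x 0 i * x 0 j | i <- enum 'I_p,
                           j <- [seq j : 'I_p <- enum 'I_p | (i < j)%N]].

Definition vech (p : nat) (x : 'rV[R]_p) : 'rV[R]_((p * p.+1)./2) :=
  \row_k (vech_seq x)`_k.

Lemma size_vech_seq (p : nat) (x : 'rV[R]_p) :
  size (vech_seq x) = (p * p.+1)./2.
Proof.
rewrite size_cat size_map size_enum_ord size_allpairs_dep.
have -> : sumn [seq size [seq j : 'I_p <- enum 'I_p | (i < j)%N]
               | i : 'I_p <- enum 'I_p] = (\sum_(i < p) i)%N.
  rewrite sumnE big_map big_enum /= [RHS](reindex_inj rev_ord_inj).
  apply: eq_bigr => i _ /=.
  rewrite size_filter -(count_map val (fun j => (i < j)%N)) val_enum_ord.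
  rewrite -size_filter.
  have -> : iota 0 p = iota 0 i.+1 ++ iota i.+1 (p - i.+1).
    by rewrite -iotaD subnKC.
  rewrite filter_cat (_ : [seq j <- iota 0 i.+1 | (i < j)%N] = [::]).
    rewrite (_ : seq.filter _ _ = iota i.+1 (p - i.+1)) ?size_iota//.
    by apply/all_filterP/allP => j; rewrite mem_iota => /andP[].
  apply/eqP; rewrite -(negbK (_ == _)) -has_filter; apply/hasPn => j.
  by rewrite mem_iota add0n ltnS -leqNgt => /andP[].
by rewrite addnC -(big_ord_recr p (fun i : 'I_p.+1 => val i)) /=
  -(big_mkord xpredT id) bin2_sum bin2 mulnC.
Qed.

Definition with_intercept (n : nat) (w : 'rV[R]_n) : 'rV[R]_n.+1 :=
  row_mx (const_mx 1 : 'rV[R]_1) w.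

Definition design_mx (n m : nat) (w : 'I_m -> 'rV[R]_n) :
    'M[R]_(m, (n.+1 * n.+2)./2) :=
  \matrix_(k, l) vech (with_intercept (w k)) 0 l.

End HalfVectorization.

(* Main.v *)
Require Import Defs.
From HB Require Import structures.
From mathcomp Require Import all_boot all_order all_algebra.
From mathcomp Require Import all_classical all_reals all_analysis.
From mathcomp Require Import measurable_realfun.
From mathcomp Require Import ring lra.

(** Write x = (1, w). Since A is independent of W, integrals of products
    f(A) g(W) factor ([integral_indep_mul]), so that x . mu and x Sigma x^T
    satisfy the averaging identities that characterize the first two
    conditional moments of Y given W = w. Every neighbourhood of a point of the
    support has positive probability and the support has probability one;
    hence two versions of a conditional moment that are continuous on the
    support agree at each of its points ([is_cond_mean_unique]). On supp(W) the
    conditional mean and variance are therefore x . mu and x Sigma x^T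
    ([cond_mean_response], [cond_var_response]), and identification becomes a
    question on linear and quadratic forms that vanish at the points (1, w).

    A quadratic form that vanishes at all (1, w), with w in a grid of three
    points per coordinate, is zero ([grid_qform0]): along an axis it is a
    polynomial of degree two with three zeros, and along two axes its mixed
    second difference isolates the mixed coefficient. Applied to the form whose
    coefficients are a linear relation between the entries of vech, this shows
    that the vectors vech(1, w) span when w runs over the grid, so that
    p(p+1)/2 of them form a matrix of full rank ([grid_rank]). Applied to the
    differences of two means and of two covariance matrices, it gives
    identification ([identified_grid]).

    Conversely, if W_j takes its values in {a, b}, then
    (w_j - (a+b)/2)^2 = ((a-b)/2)^2 on the support. This is an equality
    (u . x)^2 = (v . x)^2 with u^T u different from v^T v, so that the positive
    definite matrices 1 + u^T u and 1 + v^T v define the same quadratic form on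
    the support. Each is the covariance of a centred vector uniform on finitely
    many points, and putting that vector on the product of its own space with
    the space of W makes it independent of W ([noise_model],
    [spiked_not_identified]). *)

Set Implicit Arguments.
Unset Strict Implicit.
Unset Printing Implicit Defensive.

Import Order.TTheory GRing.Theory Num.Theory.
Import numFieldNormedType.Exports.

Local Open Scope classical_set_scope.
Local Open Scope ring_scope.

(** * Quadratic forms on a grid *)

Lemma mxsubE (V : zmodType) m n (A B : 'M[V]_(m, n)) i j :
  (A - B) i j = A i j - B i j.
Proof. by rewrite !mxE. Qed.

Lemma scalemxE (R : pzRingType) m n (c : R) (A : 'M[R]_(m, n)) i j :
  (c *: A) i j = c * A i j.
Proof. by rewrite mxE. Qed.

Section QuadraticForms.
Context (R : realType).

Definition qform (p : nat) (F : 'M[R]_p) (x : 'rV[R]_p) : R :=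
  (x *m F *m x^T) 0 0.

(** The bilinear form for which [qform F (x + y)] splits; the symmetrization
    keeps [F] arbitrary, which the triangular coefficient matrix of the entries
    of [vech] requires. *)
Definition polar (p : nat) (F : 'M[R]_p) (x y : 'rV[R]_p) : R :=
  (x *m (F + F^T) *m y^T) 0 0.

Lemma tr11E (A : 'M[R]_1) : A 0 0 = A^T 0 0.
Proof. by rewrite mxE. Qed.

Lemma qformE p (F : 'M[R]_p) x :
  qform F x = \sum_i \sum_j F i j * (x 0 i * x 0 j).
Proof.
rewrite /qform mxE exchange_big; apply: eq_bigr => j _ /=.
rewrite !mxE mulr_suml; apply: eq_bigr => i _; ring.
Qed.

Lemma qformD p (F : 'M[R]_p) x y :
  qform F (x + y) = qform F x + qform F y + polar F x y.
Proof.
have -> : polar F x y = (x *m F *m y^T) 0 0 + (y *m F *m x^T) 0 0.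
  rewrite /polar mulmxDr mulmxDl mxE; congr (_ + _).
  by rewrite tr11E !trmx_mul !trmxK mulmxA.
rewrite /qform linearD/= mulmxDr !mulmxDl !mxE; ring.
Qed.

Lemma qformZ p (F : 'M[R]_p) a x : qform F (a *: x) = a ^+ 2 * qform F x.
Proof. by rewrite /qform linearZ/= -!scalemxAl -scalemxAr !mxE mulrA. Qed.

Lemma polarC p (F : 'M[R]_p) x y : polar F x y = polar F y x.
Proof.
by rewrite /polar tr11E !trmx_mul trmxK linearD/= trmxK addrC mulmxA.
Qed.

Lemma polarDl p (F : 'M[R]_p) x y z :
  polar F (x + y) z = polar F x z + polar F y z.
Proof. by rewrite /polar !mulmxDl !mxE. Qed.

Lemma polarZl p (F : 'M[R]_p) a x y : polar F (a *: x) y = a * polar F x y.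
Proof. by rewrite /polar -!scalemxAl mxE. Qed.

Lemma polar_suml p (F : 'M[R]_p) (I : Type) (r : seq I) (a : I -> R)
    (x : I -> 'rV[R]_p) y :
  polar F (\sum_(i <- r) a i *: x i) y = \sum_(i <- r) a i * polar F (x i) y.
Proof.
rewrite (big_morph (fun x => polar F x y) (id1 := 0) (op1 := +%R)).
- by apply: eq_bigr => i _; rewrite polarZl.
- by move=> u v; rewrite polarDl.
- by rewrite /polar !mul0mx mxE.
Qed.

Lemma polarxx p (F : 'M[R]_p) x : polar F x x = 2 * qform F x.
Proof.
have := qformD F x x; rewrite -mulr2n -scaler_nat qformZ => h.
suff -> : polar F x x = 2%:R ^+ 2 * qform F x - qform F x - qform F x by ring.
by rewrite h; ring.
Qed.

Lemma polar_delta p (F : 'M[R]_p) i j :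
  polar F (delta_mx 0 i) (delta_mx 0 j) = F i j + F j i.
Proof. by rewrite /polar trmx_delta -rowE -colE !mxE. Qed.

Lemma with_intercept0 n (w : 'rV[R]_n) : with_intercept w 0 ord0 = 1.
Proof.
transitivity (row_mx (const_mx 1 : 'rV[R]_1) w 0 (lshift n ord0)).
  by congr (fun_of_matrix _ _); exact/val_inj.
by rewrite row_mxEl mxE.
Qed.

Lemma with_interceptS n (w : 'rV[R]_n) j :
  with_intercept w 0 (lift ord0 j) = w 0 j.
Proof.
transitivity (row_mx (const_mx 1 : 'rV[R]_1) w 0 (rshift 1 j)).
  by congr (fun_of_matrix _ _); exact/val_inj.
by rewrite row_mxEr.
Qed.

Lemma with_interceptE n (w : 'rV[R]_n) : with_intercept w =
  delta_mx 0 ord0 + \sum_j w 0 j *: delta_mx 0 (lift ord0 j).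
Proof.
apply/rowP => i; rewrite [RHS]mxE summxE.
case: (unliftP ord0 i) => [j|] ->.
  rewrite with_interceptS mxE/= add0r (bigD1 j)//= !mxE !eqxx mulr1.
  by rewrite big1 ?addr0// => k kj; rewrite !mxE/= (inj_eq lift_inj)
    eq_sym (negPf kj) mulr0.
rewrite with_intercept0 !mxE/= big1 ?addr0// => j _.
by rewrite !mxE/= mulr0.
Qed.

(** Moving from the grid point of index 0 along one axis restricts the form to a
    polynomial of degree 2 with three zeros: the square and the linear
    coefficients vanish. Moving along two axes then isolates the mixed
    coefficient. So the polar form vanishes on all pairs taken from
    [(1, w_0), e_1, .., e_n], which is a basis. Only the symmetric part of [F]
    is determined by the form, whence the conclusion on [F + F^T]. *)
Lemma grid_qform0 n (t : 'I_n -> 'I_3 -> R) (F : 'M[R]_n.+1) :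
    (forall j, injective (t j)) ->
    (forall k : 'I_n -> 'I_3,
      qform F (with_intercept (\row_j t j (k j))) = 0) ->
  F + F^T = 0.
Proof.
move=> tI F0.
pose x0 := with_intercept (\row_j t j ord0).
pose e j : 'rV[R]_n.+1 := delta_mx 0 (lift ord0 j).
pose s j k := t j k - t j ord0.
have s_neq0 j k : k != ord0 -> s j k != 0.
  by apply: contra; rewrite subr_eq0 => /eqP/tI ->.
have Fx0 : qform F x0 = 0 by exact: F0.
have F1 j k : qform F (x0 + s j k *: e j) = 0.
  rewrite -(F0 (fun i => if i == j then k else ord0)); congr qform.
  rewrite /x0 !with_interceptE -addrA; congr (_ + _).
  rewrite [in RHS](bigD1 j)//= [in LHS](bigD1 j)//= !mxE eqxx.
  rewrite [X in _ = _ + X](eq_bigr (fun m => t m ord0 *: e m)); last first.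
    by move=> m /negPf mj; rewrite !mxE mj.
  rewrite [X in _ + X + _ = _](eq_bigr (fun m => t m ord0 *: e m)); last first.
    by move=> m _; rewrite !mxE.
  set z := \sum_(_ < _ | _) _; rewrite -!/(e _) /s !scalerBl.
  by apply/rowP => m; rewrite !mxE; ring.
have F2 i j k l : i != j ->
    qform F ((x0 + s i k *: e i) + s j l *: e j) = 0.
  move=> ij; rewrite -(F0 (fun m => if m == i then k else
                               if m == j then l else ord0)); congr qform.
  rewrite /x0 !with_interceptE -!addrA; congr (_ + _).
  rewrite [in RHS](bigD1 i)//= [in LHS](bigD1 i)//=.
  rewrite [in RHS](bigD1 j) 1?eq_sym//= [in LHS](bigD1 j) 1?eq_sym//= !mxE.
  rewrite !eqxx [j == i]eq_sym (negPf ij).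
  rewrite [X in _ = _ + (_ + X)](eq_bigr (fun m => t m ord0 *: e m)); last first.
    by move=> m /andP[/negPf mi /negPf mj]; rewrite !mxE mi mj.
  rewrite [X in _ + (_ + X) + _ = _](eq_bigr (fun m => t m ord0 *: e m));
    last by move=> m _; rewrite !mxE.
  set z := \sum_(_ < _ | _) _; rewrite -!/(e _) /s !scalerBl.
  by apply/rowP => m; rewrite !mxE; ring.
(* s |-> qform F (x0 + s e_j) is s^2 q + s l, with zeros s1, s2 <> 0. *)
have e0 j : qform F (e j) = 0 /\ polar F x0 (e j) = 0.
  have k1 : (Ordinal (isT : 1 < 3)%N) != ord0 by [].
  have k2 : (Ordinal (isT : 2 < 3)%N) != ord0 by [].
  have := F1 j (Ordinal (isT : 1 < 3)%N).
  have := F1 j (Ordinal (isT : 2 < 3)%N).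
  rewrite !qformD !qformZ !Fx0 !add0r ![polar _ _ (_ *: _)]polarC !polarZl.
  rewrite ![polar F (e j) x0]polarC.
  move: (s_neq0 j _ k1) (s_neq0 j _ k2).
  have : s j (Ordinal (isT : 1 < 3)%N) - s j (Ordinal (isT : 2 < 3)%N) != 0.
    rewrite /s opprB addrA subrK subr_eq0; apply/eqP => /tI; by move/eqP.
  move: (s j _) (s j _) (qform _ _) (polar _ _ _) => b a q l ab a0 b0 qb qa.
  have q1 : b * q + l = 0.
    by apply: (mulfI b0); rewrite mulr0 -qb; ring.
  have q2 : a * q + l = 0.
    by apply: (mulfI a0); rewrite mulr0 -qa; ring.
  have q0 : q = 0.
    apply: (mulfI ab); rewrite mulr0.
    transitivity ((a * q + l) - (b * q + l)); first ring.
    by rewrite q1 q2 subrr.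
  by split=> //; move: q1; rewrite q0 mulr0 add0r.
have pe i j : polar F (e i) (e j) = 0.
  have [->|ij] := eqVneq i j; first by rewrite polarxx (e0 j).1 mulr0.
  have k1 : (Ordinal (isT : 1 < 3)%N) != ord0 by [].
  have := F2 i j (Ordinal (isT : 1 < 3)%N) (Ordinal (isT : 1 < 3)%N) ij.
  rewrite qformD F1 add0r qformZ (e0 j).1 mulr0 add0r polarDl.
  rewrite polarC polarZl polarC (e0 j).2 mulr0 add0r polarZl.
  rewrite polarC polarZl polarC => /eqP.
  by rewrite !mulf_eq0 !(negPf (s_neq0 _ _ k1)) => /eqP.
have d0E : delta_mx 0 ord0 = x0 + \sum_j (- t j ord0) *: e j.
  rewrite /x0 with_interceptE -addrA -big_split/= big1 ?addr0// => j _.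
  by rewrite !mxE -scalerDl addrN scale0r.
have pd0 j : polar F (delta_mx 0 ord0) (e j) = 0.
  rewrite d0E polarDl (e0 j).2 add0r polar_suml big1// => i _.
  by rewrite pe mulr0.
apply/matrixP => i j; rewrite !mxE -polar_delta.
case: (unliftP ord0 i) => [i'|] ->; case: (unliftP ord0 j) => [j'|] ->.
- exact: pe.
- by rewrite polarC pd0.
- exact: pd0.
- rewrite {1}d0E polarDl polar_suml [X in _ + X]big1 ?addr0; last first.
    by move=> k _; rewrite polarC pd0 mulr0.
  rewrite d0E polarC polarDl polarxx Fx0 mulr0 add0r polar_suml big1// => k _.
  by rewrite polarC (e0 k).2 mulr0.
Qed.

Lemma grid_sym0 n (t : 'I_n -> 'I_3 -> R) (F : 'M[R]_n.+1) :
    (forall j, injective (t j)) -> F^T = F ->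
    (forall k : 'I_n -> 'I_3,
      qform F (with_intercept (\row_j t j (k j))) = 0) ->
  F = 0.
Proof.
move=> tI FT /(grid_qform0 tI); rewrite FT -mulr2n -scaler_nat => /eqP.
by rewrite scaler_eq0 pnatr_eq0 => /eqP.
Qed.

(** As the first coordinate of [(1, w)] is 1, the linear form [u . x] takes the
    values of the quadratic form [x_0 (u . x)], to which [grid_qform0] applies. *)
Lemma grid_lin0 n (t : 'I_n -> 'I_3 -> R) (u : 'rV[R]_n.+1) :
    (forall j, injective (t j)) ->
    (forall k : 'I_n -> 'I_3,
      \sum_i u 0 i * with_intercept (\row_j t j (k j)) 0 i = 0) ->
  u = 0.
Proof.
move=> tI u0.
pose F : 'M[R]_n.+1 := \matrix_(i, j) (if i == ord0 then u 0 j else 0).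
have : F + F^T = 0.
  apply: (grid_qform0 tI) => k; rewrite qformE big_ord_recl [X in _ + X]big1.
    rewrite addr0 -[RHS](u0 k); apply: eq_bigr => j _.
    by rewrite [F _ _]mxE eqxx with_intercept0 mul1r.
  by move=> i _; apply: big1 => j _; rewrite [F _ _]mxE/= mul0r.
move=> /matrixP FF; apply/rowP => j; have := FF ord0 j; rewrite !mxE eqxx.
case: eqP => [->|_]; last by rewrite addr0.
by move/eqP; rewrite -mulr2n mulrn_eq0/= => /eqP.
Qed.

(** Listing the monomials of [vech] by their pairs of indices [i <= j] turns a
    linear relation between the entries of [vech] into an upper triangular
    coefficient matrix. *)
Definition vech_index (p : nat) : seq ('I_p * 'I_p) :=
  [seq (i, i) | i : 'I_p <- enum 'I_p] ++
  [seq (i, j) | i : 'I_p <- enum 'I_p,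
                j : 'I_p <- [seq j : 'I_p <- enum 'I_p | (i < j)%N]].

Definition vech_mon p (x : 'rV[R]_p) (ij : 'I_p * 'I_p) : R :=
  (if ij.1 == ij.2 then 1 else 2) * (x 0 ij.1 * x 0 ij.2).

Lemma vech_seqE p (x : 'rV[R]_p) :
  vech_seq x = [seq vech_mon x ij | ij <- vech_index p].
Proof.
rewrite /vech_seq /vech_index map_cat; congr (_ ++ _).
  by rewrite -map_comp; apply: eq_map => i; rewrite /vech_mon/= eqxx mul1r.
rewrite map_allpairs.
apply: (iffLR (@eq_in_allpairs_dep 'I_p (fun=> 'I_p) R _ _ _ _)) => i _ j.
rewrite mem_filter => /andP[ij _].
by rewrite /vech_mon /= ifF ?mulrA//; apply/negbTE; rewrite neq_ltn ij.
Qed.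

Lemma vech_index_le p ij : ij \in vech_index p -> (ij.1 <= ij.2)%N.
Proof.
rewrite mem_cat => /orP[/mapP[i _ ->]//|/allpairsPdep[i [j [_]]]].
by rewrite mem_filter => /andP[ij' _] ->; exact: ltnW.
Qed.

Lemma vech_index_uniq p : uniq (vech_index p).
Proof.
rewrite cat_uniq; apply/and3P; split.
- by rewrite map_inj_uniq ?enum_uniq// => i j [].
- apply/hasPn => ij /allpairsPdep[i [j [_]]].
  rewrite mem_filter => /andP[ij' _] ->; apply/mapP => -[k _ [ik jk]].
  by move: ij'; rewrite ik jk ltnn.
- apply: allpairs_uniq_dep; rewrite ?enum_uniq//.
    by move=> i _; rewrite filter_uniq// enum_uniq.
  by move=> [i j] [i' j'] _ _ [-> ->].
Qed.

Lemma size_vech_index p : size (vech_index p) = (p * p.+1)./2.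
Proof. by rewrite -(size_vech_seq (0 : 'rV[R]_p)) vech_seqE size_map. Qed.

(** A relation [c] between the columns is the vanishing on the grid of the
    quadratic form with upper triangular coefficients [c_l], or [2 c_l] off the
    diagonal; triangularity lets [F + F^T = 0] give back each [c_l]. *)
Lemma grid_vech_free n (t : 'I_n -> 'I_3 -> R)
    (c : 'I_((n.+1 * n.+2)./2) -> R) :
    (forall j, injective (t j)) ->
    (forall k : 'I_n -> 'I_3,
       \sum_l vech (with_intercept (\row_j t j (k j))) 0 l * c l = 0) ->
  forall l, c l = 0.
Proof.
move=> tI c0.
pose ix (l : 'I_((n.+1 * n.+2)./2)) := nth (ord0, ord0) (vech_index n.+1) l.
have ixin l : ix l \in vech_index n.+1 by rewrite mem_nth// size_vech_index.
have ixI : injective ix.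
  move=> l l' /eqP; rewrite nth_uniq ?size_vech_index ?vech_index_uniq//.
  by move/eqP/val_inj.
have vE x l : vech x 0 l = vech_mon x (ix l).
  by rewrite mxE vech_seqE (nth_map (ord0, ord0)) ?size_vech_index.
(* The factor with which vech weights the monomial of index l. *)
pose m l : R := if (ix l).1 == (ix l).2 then 1 else 2.
pose F : 'M[R]_n.+1 := \matrix_(i, j) \sum_(l | ix l == (i, j)) c l * m l.
have FE x : qform F x = \sum_l vech x 0 l * c l.
  rewrite qformE pair_big/= (partition_big ix predT)//=.
  apply: eq_bigr => -[i j] _ /=; rewrite mxE mulr_suml.
  by apply: eq_bigr => l /eqP; rewrite vE /vech_mon /m => ->/=; ring.
have FF : F + F^T = 0 by apply: (grid_qform0 tI) => k; rewrite FE c0.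
have F1 l : F (ix l).1 (ix l).2 = c l * m l.
  by rewrite mxE (big_pred1 l)// => l'; rewrite -surjective_pairing (inj_eq ixI).
move=> l; have /matrixP/(_ (ix l).1 (ix l).2) := FF.
rewrite [LHS]mxE [X in _ + X = _]mxE [RHS]mxE F1.
have [ii|ij] := eqVneq (ix l).1 (ix l).2.
  rewrite ii -{1}ii F1 /m ii eqxx mulr1 => /eqP.
  by rewrite -mulr2n mulrn_eq0/= => /eqP.
(* The transposed pair has decreasing indices: it is not in vech_index. *)
rewrite [F _ _]mxE big_pred0 => [|l'].
  rewrite addr0 /m (negPf ij) => /eqP.
  by rewrite mulf_eq0 pnatr_eq0 orbF => /eqP.
apply/negbTE/eqP => l'E; move: (vech_index_le (ixin l')); rewrite l'E/=.
move: (vech_index_le (ixin l)) ij; rewrite -val_eqE/= => le1 + le2.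
by rewrite eqn_leq le1 le2.
Qed.

(** The matrix with one row for each of the [3 ^ n] grid points has independent
    columns by [grid_vech_free], so it has full column rank and a square
    submatrix of the same rank can be extracted from its rows. *)
Lemma grid_rank n (t : 'I_n -> 'I_3 -> R) : (forall j, injective (t j)) ->
  exists w : 'I_((n.+1 * n.+2)./2) -> 'I_n -> 'I_3,
    \rank (design_mx (fun l => \row_j t j (w l j))) = (n.+1 * n.+2)./2.
Proof.
move=> tI.
pose g (i : 'I_(#|{ffun 'I_n -> 'I_3}|)) : 'I_n -> 'I_3 := enum_val i.
pose D := design_mx (fun i => \row_j t j (g i j)).
have Dfull : row_full D.
  rewrite /row_full -mxrank_tr -/(row_free D^T); apply: inj_row_free => c cD.
  apply/rowP => l; rewrite [RHS]mxE.
  apply: (grid_vech_free (c := fun l => c 0 l) tI) => k.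
  have /rowP/(_ (enum_rank (finfun k))) := cD.
  rewrite [LHS]mxE [RHS]mxE => cDk; rewrite -[RHS]cDk; apply: eq_bigr => l' _.
  rewrite [D^T _ _]mxE [D _ _]mxE mulrC; congr (_ * vech (with_intercept _) 0 _).
  by apply/rowP => j; rewrite !mxE /g enum_rankK ffunE.
exists (fun l => g (fullrankfun Dfull l)).
rewrite -[RHS](mxrank_fullrowsub Dfull); congr mxrank.
by apply/matrixP => i j; rewrite !mxE.
Qed.
End QuadraticForms.
(** * The support of a random vector *)

Section BorelRows.
Context (R : realType) (n : nat).

Lemma measurable_open_rV (U : set 'rV[R]_n) :
  open U -> measurable (U : set (borel_rV R n)).
Proof. by move=> oU; apply: sub_sigma_algebra. Qed.

Lemma measurable_closed_rV (C : set 'rV[R]_n) :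
  closed C -> measurable (C : set (borel_rV R n)).
Proof.
move=> cC; rewrite -[C]setCK; apply: measurableC; apply: measurable_open_rV.
exact: closed_openC.
Qed.

Lemma continuous_measurable_rV (g : 'rV[R]_n -> R) :
  continuous g -> measurable_fun [set: borel_rV R n] (g : borel_rV R n -> R).
Proof.
move=> cg; apply: (measurability _ (RGenOpens.measurableE R)) => _ [_ [a [b ->]] <-].
rewrite setTI; apply: measurable_open_rV; apply: open_comp; last exact: interval_open.
by move=> x _; exact: cg.
Qed.

(** A bounded set lies in a closed ball, which is compact. *)
Lemma continuous_bounded_rV (g : 'rV[R]_n -> R) (B : set 'rV[R]_n) :
  continuous g -> bounded_set B -> [bounded g w | w in B].
Proof.
move=> cg [M [Mr BM]].
pose K := [set w : 'rV[R]_n | `|w| <= M + 1].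
have cK : compact K.
  apply: bounded_closed_compact.
    exists (M + 1); split; first by rewrite realD.
    by move=> x Mx w /le_trans; apply; exact: ltW.
  have -> : K = (fun w : 'rV[R]_n => `|w|) @^-1` [set x | x <= M + 1] by [].
  apply: preimage_closed; last exact: closed_le.
  by move=> w _; exact: norm_continuous.
have /compact_bounded[N [Nr gN]] : compact (g @` K).
  by apply: continuous_compact cK; exact: continuous_subspaceT.
exists N; split=> // x Nx w Bw; apply: (gN x Nx).
by exists w => //; apply: (BM (M + 1)) => //; rewrite ltrDl.
Qed.

End BorelRows.

Section Support.
Context d (T : measurableType d) (R : realType) (P : probability T R) (n : nat).
Variable X : {RV P >-> borel_rV R n}.
Let W : T -> 'rV[R]_n := X.

Lemma measurable_preimage_rV (B : set 'rV[R]_n) :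
  measurable (B : set (borel_rV R n)) -> measurable (W @^-1` B).
Proof. by move=> mB; rewrite -[_ @^-1` _]setTI; exact: measurable_funP. Qed.

Lemma supp_closed : closed (supp P W).
Proof. by apply: closed_bigI => C [[]]. Qed.

Lemma supp_openP (w : 'rV[R]_n) :
  supp P W w <-> forall U, open U -> U w -> (0 < P (W @^-1` U))%E.
Proof.
split=> [sw U oU Uw|h C [[cC PC] _]].
  rewrite lt0e measure_ge0 andbT; apply/eqP => PU0.
  suff : (~` U) w by [].
  apply: sw; split=> //; split; first exact: open_closedC.
  rewrite preimage_setC probability_setC ?PU0 ?sube0//.
  apply: measurable_preimage_rV; exact: measurable_open_rV.
apply: contrapT => nCw.
have := h _ (closed_openC cC) nCw.
rewrite preimage_setC probability_setC.
  by rewrite PC subee// ltxx.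
by apply: measurable_preimage_rV; exact: measurable_closed_rV.
Qed.

(** The topology has a countable base, the balls with rational centre and
    radius: the complement of the support is covered by the countably many of
    them that are null. *)
Lemma probability_supp : P (W @^-1` supp P W) = 1%E.
Proof.
have mS : measurable (W @^-1` supp P W).
  apply: measurable_preimage_rV; apply: measurable_closed_rV; exact: supp_closed.
pose b (q : 'rV[rat]_n * rat) : set 'rV[R]_n :=
  ball (map_mx ratr q.1 : 'rV[R]_n) (ratr q.2).
have mb q : measurable (W @^-1` b q).
  apply: measurable_preimage_rV; apply: measurable_open_rV; exact: ball_open.
pose N k : set T := if unpickle k is Some q then
  if P (W @^-1` b q) == 0%E then W @^-1` b q else set0 else set0.
have PN k : P.-negligible (N k).
  rewrite /N; case: unpickle => [q|]; last exact: negligible_set0.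
  by case: eqP => [?|_]; [exists (W @^-1` b q); split|exact: negligible_set0].
suff : P (~` (W @^-1` supp P W)) = 0%E.
  move=> S0; rewrite -[W @^-1` _]setCK probability_setC; last exact: measurableC.
  by rewrite S0 sube0.
apply: measure_negligible; first exact: measurableC.
apply: negligibleS (negligible_bigcup PN) => t.
rewrite /setC/= => /supp_openP/existsNP[U /not_implyP[oU /not_implyP[UWt]]].
move=> PU0.
have {}PU0 : P (W @^-1` U) = 0%E.
  by apply/eqP; rewrite -measure_le0 leNgt; apply/negP.
have /nbhs_ballP[e /= e0 eU] : nbhs (W t) U by exact: open_nbhs_nbhs.
have e20 : 0 < e / 2 by rewrite divr_gt0.
have [r] := @rat_in_itvoo R 0 (e / 2) e20; rewrite in_itv/= => /andP[r0 re].
have rP j : exists q : rat, `|W t 0 j - ratr q| < ratr r.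
  have [|q] := @rat_in_itvoo R (W t 0 j - ratr r) (W t 0 j + ratr r).
    by rewrite ltrD2l gt0_cp.
  rewrite in_itv/= => /andP[q1 q2]; exists q.
  by rewrite ltr_norml; apply/andP; split; lra.
have [q qP] := choice rP.
pose z := (\row_j q j, r) : 'rV[rat]_n * rat.
have zt : b z (W t).
  split=> // i j; rewrite /b/= !mxE (ord1 i) /ball/= distrC; exact: qP.
have zU : b z `<=` U.
  move=> w zw; apply: eU; apply: (@le_ball _ _ _ (ratr r + ratr r)); first lra.
  by apply: ball_triangle zw; exact: ball_sym.
exists (pickle z) => //; rewrite /N pickleK ifT//.
rewrite -measure_le0 -PU0 le_measure ?inE//; last by move=> ? /zU.
by apply: measurable_preimage_rV; exact: measurable_open_rV.
Qed.

End Support.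
(** * Uniqueness of continuous conditional means *)

Section CondMean.
Context d (T : measurableType d) (R : realType) (P : probability T R) (n : nat).
Variable X : {RV P >-> borel_rV R n}.
Let W : T -> 'rV[R]_n := X.

Lemma bounded_ball_rV (w : 'rV[R]_n) e : bounded_set (ball w e).
Proof.
exists (`|w| + e); split; first exact: num_real.
move=> x xe v; rewrite -ball_normE /ball_/= => vw; apply/ltW/(le_lt_trans _ xe).
rewrite -[v](subrK w) addrC (le_trans (ler_normD _ _))// lerD2l.
by rewrite distrC ltW.
Qed.

Lemma probability_setI_supp (B : set 'rV[R]_n) :
    measurable (B : set (borel_rV R n)) ->
  P (W @^-1` B) = P (W @^-1` (B `&` supp P W)).
Proof.
move=> mB; have mWB := measurable_preimage_rV X mB.
have mWS : measurable (W @^-1` supp P W).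
  apply: measurable_preimage_rV; apply: measurable_closed_rV; exact: supp_closed.
rewrite preimage_setI (measureDI P _ mWS)//.
rewrite -[RHS]add0e; congr (_ + _)%E.
apply/eqP; rewrite -measure_le0 (@le_trans _ _ (P (~` (W @^-1` supp P W))))//.
  apply: le_measure; rewrite ?inE; [exact: measurableD|exact: measurableC|].
  by move=> t [].
by rewrite probability_setC// probability_supp subee.
Qed.

(** If [g1 w > g2 w], then [g1 - g2] exceeds some [del > 0] on the trace on the
    support of a ball around [w]. That trace is a bounded Borel set of positive
    probability, over which [g1] and [g2] have the same integral. *)
Lemma is_cond_mean_le (Z : T -> R) g1 g2 w :
  is_cond_mean P W Z g1 -> is_cond_mean P W Z g2 -> supp P W w -> g1 w <= g2 w.
Proof.
move=> [mg1 cg1 Zg1] [mg2 cg2 Zg2] Sw; rewrite leNgt; apply/negP => g21.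
pose h x := g1 x - g2 x.
pose del := h w / 2.
have hw0 : 0 < h w by rewrite subr_gt0.
have del0 : 0 < del by rewrite divr_gt0.
have delw : del < h w by rewrite /del; lra.
have ch : {within supp P W, continuous h}.
  by move=> x; apply: cvgB; [exact: cg1|exact: cg2].
have /nbhs_ballP[e /= e0 eh] : nbhs w [set x | supp P W x -> del < h x].
  have /cvgr_gt/(_ _ delw) := ch w.
  move=> H; have : nbhs (w : subspace (supp P W)) [set x | del < h x] by exact: H.
  by rewrite /nbhs/= -nbhs_subspace_in.
pose B := ball w e `&` supp P W.
have mball : measurable (ball w e : set (borel_rV R n)).
  by apply: measurable_open_rV; exact: ball_open.
have mS : measurable (supp P W : set (borel_rV R n)).
  by apply: measurable_closed_rV; exact: supp_closed.
have mB : measurable (B : set (borel_rV R n)) by exact: measurableI.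
have bB : bounded_set B.
  have [M [Mr MB]] := bounded_ball_rV w e; exists M; split=> // x Mx v [/= + _].
  exact: MB.
have PB : (0 < P (W @^-1` B))%E.
  have := (supp_openP X w).1 Sw _ (ball_open w e) (ballxx w e0).
  by rewrite (probability_setI_supp mball).
have [iZ ig1 ig1E] := Zg1 _ mB bB.
have [_ ig2 ig2E] := Zg2 _ mB bB.
have mWB := measurable_preimage_rV X mB.
have : (\int[P]_(t in W @^-1` B) del%:E <=
        \int[P]_(t in W @^-1` B) ((g1 (W t))%:E - (g2 (W t))%:E))%E.
  apply: le_integral => //.
  - apply: finite_measure_integrable_cst => //.
  - exact: integrableB.
  - by move=> t /set_mem[bt St]; rewrite -EFinB lee_fin; exact/ltW/(eh _ bt St).
rewrite integralB// -ig1E -ig2E subee; last exact: integrable_fin_num.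
rewrite integral_cst// leNgt mule_gt0//.
Qed.
Lemma is_cond_mean_unique (Z : T -> R) g1 g2 :
    is_cond_mean P W Z g1 -> is_cond_mean P W Z g2 ->
  forall w, supp P W w -> g1 w = g2 w.
Proof.
by move=> h1 h2 w Sw; apply/eqP; rewrite eq_le !(@is_cond_mean_le Z).
Qed.
End CondMean.
(** * Products of functions of independent variables *)

Section IndependentProduct.
Context d d1 d2 (T : measurableType d) (T1 : measurableType d1)
  (T2 : measurableType d2) (R : realType) (P : probability T R).
Variables (X : {RV P >-> T1}) (Y : {RV P >-> T2}).
Hypothesis XYind : independent_RV X Y.
Variables (f : T1 -> R) (g : T2 -> R).
Hypotheses (mf : measurable_fun [set: T1] f) (mg : measurable_fun [set: T2] g).
Hypotheses (fX : P.-integrable [set: T] (EFin \o (f \o X)))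
           (gY : P.-integrable [set: T] (EFin \o (g \o Y))).

Let XY (t : T) : T1 * T2 := (X t, Y t).
Let mXY : measurable_fun [set: T] XY.
Proof. by apply: measurable_fun_pair; exact: measurable_funP. Qed.
HB.instance Definition _ := isMeasurableFun.Build _ _ _ _ XY mXY.

Let muX := distribution P X.
Let muY := distribution P Y.
Let h (z : T1 * T2) : \bar R := (f z.1 * g z.2)%:E.

Let mh : measurable_fun [set: T1 * T2] h.
Proof.
apply/measurable_EFinP; apply: measurable_funM.
  exact: measurableT_comp mf measurable_fst.
exact: measurableT_comp mg measurable_snd.
Qed.

Let law_XY (S : set (T1 * T2)) : measurable S ->
  (muX \x muY)%E S = distribution P XY S.
Proof.
apply: product_measure_unique => B C mB mC.
by rewrite -XYind.
Qed.

Let igX : muX.-integrable [set: T1] (EFin \o f).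
Proof. by apply: integrable_pushforward => //; exact/measurable_EFinP. Qed.

Let igY : muY.-integrable [set: T2] (EFin \o g).
Proof. by apply: integrable_pushforward => //; exact/measurable_EFinP. Qed.

Let ih : (muX \x muY)%E.-integrable [set: T1 * T2] h.
Proof.
apply/integrable12ltyP => //.
have /integrableP[_ foo] := igX; have /integrableP[_ goo] := igY.
rewrite (eq_integral (fun x => `|(f x)%:E| * \int[muY]_y `|(g y)%:E|)%E).
  rewrite ge0_integralZr//; last exact: integral_ge0.
    rewrite lte_mul_pinfty//; first exact: integral_ge0.
    by rewrite ge0_fin_numE//; exact: integral_ge0.
  by apply: measurableT_comp => //; exact/measurable_EFinP.
move=> x _; rewrite -ge0_integralZl//; last first.
  by apply: measurableT_comp => //; exact/measurable_EFinP.
by apply: eq_integral => y _; rewrite /h/= normrM.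
Qed.

(** Independence says that the law of [(X, Y)] is the product of the laws of [X]
    and [Y] on rectangles, hence everywhere; Tonelli then splits the integral
    of the absolute value. *)
Lemma integrable_indep_mul :
  P.-integrable [set: T] (fun t => (f (X t) * g (Y t))%:E).
Proof.
have -> : (fun t => (f (X t) * g (Y t))%:E) = h \o XY by [].
apply/integrableP; split; first exact: measurableT_comp.
have /integrableP[_] := ih.
suff -> : (\int[muX \x muY]_x `|h x| = \int[P]_x `|(h \o XY) x|)%E by [].
rewrite -[RHS](@ge0_integral_distribution _ _ _ _ _ P XY (abse \o h))//.
- by apply: eq_measure_integral => S mS _; exact: law_XY.
- exact: measurableT_comp.
- by move=> y; exact: abse_ge0.
Qed.

Lemma integral_indep_mul : (\int[P]_t (f (X t) * g (Y t))%:E =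
  \int[P]_t (f (X t))%:E * \int[P]_t (g (Y t))%:E)%E.
Proof.
have := @integral_distribution _ _ _ _ _ P XY h mh integrable_indep_mul.
rewrite /comp/= /h/= => <-.
rewrite (eq_measure_integral (muX \x muY)%E) => [|S mS _]; last exact/esym/law_XY.
rewrite -(integral12_prod_meas1 ih) /fubini_F /h/=.
rewrite (eq_integral (fun x => (f x)%:E * \int[muY]_y (g y)%:E)%E).
  have cfin := integrable_fin_num measurableT igY.
  rewrite -(fineK cfin) integralZr// fineK//.
  congr (_ * _)%E.
    by rewrite (@integral_distribution _ _ _ _ _ P X (EFin \o f))//; exact/measurable_EFinP.
  by rewrite (@integral_distribution _ _ _ _ _ P Y (EFin \o g))//; exact/measurable_EFinP.
move=> x _; rewrite -integralZl//.
Qed.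
End IndependentProduct.

Section CondMeanBilinear.
Context d (T : measurableType d) (R : realType) (P : probability T R) (n : nat).
Variable X : {RV P >-> borel_rV R n}.
Let W : T -> 'rV[R]_n := X.

Lemma is_cond_mean0 : is_cond_mean P W (fun=> 0) (fun=> 0).
Proof.
split; [exact: measurable_cst|by move=> x; exact: cvg_cst|].
move=> B mB _; have mWB := measurable_preimage_rV X mB.
by split=> //; exact: integrable0.
Qed.

Lemma is_cond_meanD Z1 Z2 g1 g2 :
    is_cond_mean P W Z1 g1 -> is_cond_mean P W Z2 g2 ->
  is_cond_mean P W (fun t => Z1 t + Z2 t) (fun w => g1 w + g2 w).
Proof.
move=> [mg1 cg1 Zg1] [mg2 cg2 Zg2]; split.
- exact: measurable_funD.
- by move=> x; apply: cvgD; [exact: cg1|exact: cg2].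
- move=> B mB bB; have mWB := measurable_preimage_rV X mB.
  have [iZ1 ig1 e1] := Zg1 _ mB bB; have [iZ2 ig2 e2] := Zg2 _ mB bB.
  split; [exact: (integrableD mWB iZ1 iZ2)|exact: (integrableD mWB ig1 ig2)|].
  rewrite (integralD mWB iZ1 iZ2) (integralD mWB ig1 ig2).
  by congr (_ + _)%E.
Qed.

Lemma is_cond_mean_sum (I : Type) (r : seq I) (Z : I -> T -> R)
    (g : I -> 'rV[R]_n -> R) :
    (forall i, is_cond_mean P W (Z i) (g i)) ->
  is_cond_mean P W (fun t => \sum_(i <- r) Z i t) (fun w => \sum_(i <- r) g i w).
Proof.
move=> Zg; elim: r => [|i r IH].
  under eq_fun do rewrite big_nil.
  under [X in is_cond_mean _ _ _ X]eq_fun do rewrite big_nil.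
  exact: is_cond_mean0.
under eq_fun do rewrite big_cons.
under [X in is_cond_mean _ _ _ X]eq_fun do rewrite big_cons.
exact: is_cond_meanD.
Qed.

(** The support has probability one, so that [Z] matters only where [W] lies in
    it. This is how a conditional mean known on the support only can be
    replaced inside the conditional variance. *)
Lemma is_cond_mean_eq_supp Z Z' g :
    measurable_fun [set: T] Z -> measurable_fun [set: T] Z' ->
    (forall t, supp P W (W t) -> Z t = Z' t) ->
  is_cond_mean P W Z g -> is_cond_mean P W Z' g.
Proof.
move=> mZ mZ' ZZ' [mg cg Zg]; split=> // B mB bB.
have mWB := measurable_preimage_rV X mB.
have [iZ ig e] := Zg _ mB bB.
have mN : measurable (~` (W @^-1` supp P W)).
  apply: measurableC; apply: measurable_preimage_rV; apply: measurable_closed_rV.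
  exact: supp_closed.
have PN : P (~` (W @^-1` supp P W)) = 0%E.
  rewrite probability_setC ?probability_supp ?subee//.
  rewrite -[_ @^-1` _]setCK; exact: measurableC.
have ZZN : {in W @^-1` B `\` ~` (W @^-1` supp P W), EFin \o Z =1 EFin \o Z'}.
  by move=> t /set_mem[_ /contrapT St]; rewrite /= ZZ'.
have iZ' : P.-integrable (W @^-1` B) (EFin \o Z').
  apply/(negligible_integrable mN) => //.
    exact/measurable_EFinP/measurable_funTS.
  apply: eq_integrable ZZN _; first exact: measurableD.
  apply: integrableS iZ => //; exact: measurableD.
split=> //; rewrite -e.
rewrite (negligible_integral mN mWB iZ' PN) (negligible_integral mN mWB iZ PN).
by apply: eq_integral => t tD; rewrite -[LHS](ZZN t).
Qed.

Section Mul.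
Context d1 (T1 : measurableType d1) (A : {RV P >-> T1}).
Hypothesis AX : independent_RV A X.

(** On the event that [W] lies in a bounded set [B], the factor [g (W t)] is
    bounded, hence integrable: the product formula applies to [f] and to the
    function equal to [g] on [B] and to 0 elsewhere. *)
Lemma is_cond_mean_mul (f : T1 -> R) (g : 'rV[R]_n -> R) :
    measurable_fun [set: T1] f -> P.-integrable [set: T] (EFin \o (f \o A)) ->
    continuous g ->
  is_cond_mean P W (fun t => f (A t) * g (W t))
    (fun w => fine 'E_P[f \o A] * g w).
Proof.
move=> mf fA cg.
have mg : measurable_fun [set: borel_rV R n] (g : borel_rV R n -> R).
  exact: continuous_measurable_rV.
split.
- by apply: measurable_funM => //; exact: measurable_cst.
- apply: continuous_subspaceT => w; set c := fine _.
  have cc : {for w, continuous (fun=> c : R)} by exact: cst_continuous.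
  exact: (continuousM cc (cg w)).
move=> B mB bB; have mWB := measurable_preimage_rV X mB.
have igB : P.-integrable (W @^-1` B) (EFin \o (g \o W)).
  apply: measurable_bounded_integrable => //.
  - by rewrite (le_lt_trans (probability_le1 P mWB))// ltry.
  - by apply: measurable_funTS; exact: measurableT_comp mg (measurable_funP X).
  - have [K [Kr gK]] := continuous_bounded_rV cg bB.
    by exists K; split=> // x Kx t Bt; exact: gK.
pose gB (w : borel_rV R n) : R := g w * \1_B w.
have mgB : measurable_fun [set: borel_rV R n] gB.
  by apply: measurable_funM => //; exact: measurable_indic.
have gBE : EFin \o (gB \o W) = (EFin \o (g \o W)) \_ (W @^-1` B).
  apply/funext => t; rewrite patchE /gB /= indicE.
  have -> : (t \in W @^-1` B) = (W t \in B) by apply/idP/idP; rewrite !inE.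
  by case: ifP; rewrite ?mulr1 ?mulr0.
have igBT : P.-integrable [set: T] (EFin \o (gB \o X)).
  by rewrite -[gB \o X]/(gB \o W) gBE; apply/(integrable_mkcond _ mWB).
have fgE : (fun t => (f (A t) * gB (X t))%:E) =
    (fun t => (f (A t) * g (W t))%:E) \_ (W @^-1` B).
  apply/funext => t; rewrite patchE /gB /= indicE.
  have -> : (t \in W @^-1` B) = (W t \in B) by apply/idP/idP; rewrite !inE.
  by case: ifP; rewrite ?mulr1 ?mulr0.
have := integrable_indep_mul AX mf mgB fA igBT.
have := integral_indep_mul AX mf mgB fA igBT.
rewrite fgE -integral_mkcond => fgI /(integrable_mkcond _ mWB) ifg.
split => //; first exact: integrableZl igB.
rewrite fgI.
have -> : (\int[P]_t (gB (X t))%:E = \int[P]_(t in W @^-1` B) (g (W t))%:E)%E.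
  by rewrite [RHS]integral_mkcond -gBE.
rewrite unlock -[X in (X * _)%E]fineK; last exact: (integrable_fin_num _ fA).
by rewrite -integralZl.
Qed.

End Mul.
End CondMeanBilinear.
(** * Conditional moments of the response *)

Section ModelMoments.
Context (R : realType) (n : nat) (M : rc_model R n).
Let P := rc_P M.
Let W := @covariates R n M.
Let A := @coefficients R n M.

Lemma measurable_coord m (i : 'I_m) :
  measurable_fun [set: borel_rV R m] (fun x : 'rV[R]_m => x 0 i).
Proof. by apply: continuous_measurable_rV => x; exact: coord_continuous. Qed.

Lemma continuous_with_intercept i :
  continuous (fun w : 'rV[R]_n => with_intercept w 0 i).
Proof.
case: (unliftP ord0 i) => [j|] ->.
  under eq_fun do rewrite with_interceptS.
  by move=> x; exact: coord_continuous.
under eq_fun do rewrite with_intercept0.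
by move=> x; exact: cst_continuous.
Qed.

Lemma responseE t :
  @response R n M t = \sum_i A t 0 i * with_intercept (W t) 0 i.
Proof.
rewrite /response big_ord_recl with_intercept0 mulr1; congr (_ + _).
by apply: eq_bigr => j _; rewrite with_interceptS mulrC.
Qed.

Lemma Lfun1_coef i : (fun t => A t 0 i) \in Lfun P 1%E.
Proof.
by apply: Lfun_subset12; [exact: fin_num_measure|exact: rc_second_moments].
Qed.

Lemma integrable_coef i : P.-integrable [set: _] (EFin \o (fun t => A t 0 i)).
Proof. by apply/Lfun1_integrable; exact: Lfun1_coef. Qed.

Definition mean_form (w : 'rV[R]_n) : R :=
  \sum_i mean_vec M 0 i * with_intercept w 0 i.

Lemma is_cond_mean_response : is_cond_mean P W (@response R n M) mean_form.
Proof.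
have -> : @response R n M = fun t => \sum_i A t 0 i * with_intercept (W t) 0 i.
  by apply/funext => t; exact: responseE.
have -> : mean_form =
    fun w => \sum_i fine 'E_P[fun t => A t 0 i] * with_intercept w 0 i.
  by apply/funext => w; apply: eq_bigr => i _; rewrite mxE.
apply: is_cond_mean_sum => i.
apply: (is_cond_mean_mul (rc_independent M) (measurable_coord i)).
  exact: integrable_coef.
exact: continuous_with_intercept.
Qed.

Lemma is_cond_mean_cond_mean :
  is_cond_mean P W (@response R n M) (cond_mean P W (@response R n M)).
Proof. exact: (xgetPex _ (ex_intro _ _ is_cond_mean_response)). Qed.

Lemma cond_mean_response w : suppW M w ->
  cond_mean P W (@response R n M) w = mean_form w.
Proof.
exact: (is_cond_mean_unique is_cond_mean_cond_mean is_cond_mean_response).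
Qed.

Lemma measurable_response : measurable_fun [set: _] (@response R n M).
Proof.
have -> : @response R n M = fun t => \sum_i A t 0 i * with_intercept (W t) 0 i.
  by apply/funext => t; exact: responseE.
apply: measurable_sum => i; apply: measurable_funM.
  exact: measurableT_comp (measurable_coord i) (measurable_funP (rc_A M)).
have mg := continuous_measurable_rV (@continuous_with_intercept i).
exact: measurableT_comp mg (measurable_funP (rc_W M)).
Qed.

Definition centered_prod (ij : 'I_n.+1 * 'I_n.+1) (a : 'rV[R]_n.+1) : R :=
  (a 0 ij.1 - mean_vec M 0 ij.1) * (a 0 ij.2 - mean_vec M 0 ij.2).

Lemma measurable_centered_prod ij :
  measurable_fun [set: borel_rV R n.+1] (centered_prod ij).
Proof.
by apply: measurable_funM; apply: measurable_funB => //; exact: measurable_coord.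
Qed.

Lemma integrable_centered_prod ij :
  P.-integrable [set: _] (EFin \o (centered_prod ij \o A)).
Proof.
apply/Lfun1_integrable.
have L2 i : (fun t => A t 0 i - mean_vec M 0 i) \in Lfun P 2%:E.
  have -> : (fun t => A t 0 i - mean_vec M 0 i) =
      ((fun t => A t 0 i) - cst (mean_vec M 0 i))%R by [].
  rewrite rpredB ?lee1n// => ?; last exact: Lfun_cst.
  exact: (rc_second_moments M i).
exact: (Lfun2_mul_Lfun1 (L2 ij.1) (L2 ij.2)).
Qed.

Lemma cov_mxE i j : cov_mx M i j = fine 'E_P[centered_prod (i, j) \o A].
Proof.
rewrite mxE covariance.unlock; congr (fine 'E_P[_]).
by apply/funext => t; rewrite /centered_prod/= !mxE.
Qed.

(** With the mean form in place of the selected version of the conditional mean,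
    the squared residual is the sum over [i, j] of
    [(A_i - mu_i) (A_j - mu_j) x_i x_j] where [x = (1, W)], each term of which
    separates [A] from [W]. *)
Lemma is_cond_mean_var :
  is_cond_mean P W
    (fun t => (@response R n M t - cond_mean P W (@response R n M) (W t)) ^+ 2)
    (fun w => qform (cov_mx M) (with_intercept w)).
Proof.
have [mcm _ _] := is_cond_mean_cond_mean.
have [mmf _ _] := is_cond_mean_response.
have mY g : measurable_fun [set: borel_rV R n] (g : borel_rV R n -> R) ->
    measurable_fun [set: _] (fun t => (@response R n M t - g (W t)) ^+ 2).
  move=> mg; apply: measurable_funX; apply: measurable_funB.
    exact: measurable_response.
  exact: measurableT_comp mg (measurable_funP (rc_W M)).
apply: (is_cond_mean_eq_supp (mY _ mmf) (mY _ mcm)).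
  by move=> t St; rewrite cond_mean_response.
have -> : (fun t => (@response R n M t - mean_form (W t)) ^+ 2) =
    fun t => \sum_(ij : 'I_n.+1 * 'I_n.+1) centered_prod ij (A t) *
      (with_intercept (W t) 0 ij.1 * with_intercept (W t) 0 ij.2).
  apply/funext => t; rewrite responseE /mean_form -sumrB expr2 mulr_suml.
  transitivity (\sum_i \sum_j centered_prod (i, j) (A t) *
      (with_intercept (W t) 0 i * with_intercept (W t) 0 j)); last first.
    by rewrite pair_bigA; apply: eq_bigr => -[].
  apply: eq_bigr => i _; rewrite mulr_sumr; apply: eq_bigr => j _.
  by rewrite /centered_prod /=; ring.
have -> : (fun w => qform (cov_mx M) (with_intercept w)) =
    fun w => \sum_(ij : 'I_n.+1 * 'I_n.+1) fine 'E_P[centered_prod ij \o A] *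
      (with_intercept w 0 ij.1 * with_intercept w 0 ij.2).
  apply/funext => w; rewrite qformE pair_big/=.
  by apply: eq_bigr => -[i j] _; rewrite cov_mxE.
apply: is_cond_mean_sum => ij.
apply: (is_cond_mean_mul (rc_independent M)
  (g := fun w => with_intercept w 0 ij.1 * with_intercept w 0 ij.2)
  (measurable_centered_prod ij)).
  exact: integrable_centered_prod.
move=> w; apply: continuousM; exact: continuous_with_intercept.
Qed.

Lemma cond_var_response w : suppW M w ->
  cond_var P W (@response R n M) w = qform (cov_mx M) (with_intercept w).
Proof.
have h := xgetPex (fun=> 0) (ex_intro _ _ is_cond_mean_var).
exact: (is_cond_mean_unique h is_cond_mean_var).
Qed.

End ModelMoments.
(** * Identification on a grid *)

Lemma card_grid (R : realType) n (T : 'I_n -> set R) :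
    (forall j, (T j #= `I_3)%card) ->
  exists2 t : 'I_n -> 'I_3 -> R, (forall j, injective (t j)) &
    forall j k, T j (t j k).
Proof.
move=> T3.
have /choice[t tP] : forall j, exists t : 'I_3 -> R,
    injective t /\ forall k, T j (t k).
  move=> j.
  have /eq_cardSP[a Ta /eq_cardSP[b [Tb ba] /eq_cardSP[c [[Tc ca] cb] _]]] := T3 j.
  exists (tnth [tuple a; b; c]); split; last by case=> -[|[|[|]]].
  apply/tuple_uniqP; rewrite /= !inE !negb_or andbT.
  apply/andP; split; [apply/andP; split|]; apply/eqP => E.
  - exact: ba.
  - exact: ca.
  - exact: cb.
by exists t => j; have [] := tP j.
Qed.

Lemma suppW_same_law (R : realType) n (M M0 : rc_model R n) :
  same_covariate_law M M0 -> suppW M = suppW M0.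
Proof.
move=> MM; rewrite /suppW /supp; congr smallest.
apply/seteqP; split=> C [cC PC]; split=> //; rewrite -PC.
  by have /esym := MM _ (measurable_closed_rV cC).
exact: MM _ (measurable_closed_rV cC).
Qed.

(** Equal conditional moments on the grid mean that a linear form, with
    coefficients the difference of the means, and a quadratic form, with matrix
    the difference of the covariances, vanish there. *)
Lemma identified_grid (R : realType) n (M0 : rc_model R n)
    (t : 'I_n -> 'I_3 -> R) (C : rc_model R n -> Prop) :
    (forall j, injective (t j)) ->
    (forall k : 'I_n -> 'I_3, suppW M0 (\row_j t j (k j))) ->
  identified_in C M0.
Proof.
move=> tI tS M M' MM0 M'M0 _ _ same.
have sM := suppW_same_law MM0; have sM' := suppW_same_law M'M0.
split; apply/eqP; rewrite -subr_eq0; apply/eqP.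
  apply: (grid_lin0 tI) => k.
  have [+ _] := same _ (tS k).
  rewrite !cond_mean_response ?sM ?sM'// => /eqP.
  rewrite -subr_eq0 -sumrB => /eqP s0; rewrite -[RHS]s0; apply: eq_bigr => i _.
  by rewrite mxsubE mulrBl.
have covT (N : rc_model R n) : (cov_mx N)^T = cov_mx N.
  by apply/matrixP => i j; rewrite !mxE covarianceC.
apply: (grid_sym0 tI); first by rewrite linearB/= !covT.
move=> k; have [_] := same _ (tS k).
rewrite !cond_var_response ?sM ?sM'// => /eqP.
rewrite -subr_eq0 => /eqP s0.
by rewrite /qform mulmxBr mulmxBl mxsubE.
Qed.
(** * Models with prescribed covariance *)

Section UniformOnPoints.
Context d (T : measurableType d) (R : realType) (N : nat) (v : nat -> T).

Definition unif_wt : {nonneg R} := (N.+1%:R^-1)%:nng.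

Definition unif_points : set T -> \bar R :=
  msum (fun k => mscale unif_wt (\d_(v k))) N.+1.

HB.instance Definition _ := Measure.on unif_points.

Lemma unif_points_setT : unif_points [set: T] = 1%E.
Proof.
rewrite /unif_points /msum/= (eq_bigr (fun=> unif_wt%:num%:E)); last first.
  by move=> k _; rewrite /mscale/= diracT mule1.
rewrite sumEFin/= sumr_const card_ord -[_ *+ _]mulr_natr mulVf//.
Qed.

HB.instance Definition _ :=
  Measure_isProbability.Build _ _ _ unif_points unif_points_setT.

Lemma ge0_integral_unif_points (f : T -> \bar R) :
    measurable_fun [set: T] f -> (forall x, 0 <= f x)%E ->
  (\int[unif_points]_x f x = \sum_(k < N.+1) unif_wt%:num%:E * f (v k))%E.
Proof.
move=> mf f0.
rewrite ge0_integral_measure_sum//; apply: eq_bigr => k _.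
by rewrite ge0_integral_mscale// integral_dirac// diracT mul1e.
Qed.

Lemma integral_unif_points (f : T -> R) : measurable_fun [set: T] f ->
  (\int[unif_points]_x (f x)%:E = (N.+1%:R^-1 * \sum_(k < N.+1) f (v k))%:E)%E.
Proof.
move=> mf; rewrite (_ : (fun x => (f x)%:E) = EFin \o f)// integralE.
rewrite ge0_integral_unif_points//; last exact/measurable_funepos/measurable_EFinP.
rewrite ge0_integral_unif_points//; last exact/measurable_funeneg/measurable_EFinP.
rewrite funerpos funerneg/=.
rewrite !sumEFin -EFinB -sumrB mulr_sumr; congr EFin.
apply: eq_bigr => k _.
by rewrite /= -mulrBr -[in RHS](funrposBneg f).
Qed.

End UniformOnPoints.

Section NoiseModel.
Context (R : realType) (n : nat) (M0 : rc_model R n) (N : nat)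
  (v : nat -> borel_rV R n.+1).

Let Q : probability (borel_rV R n.+1) R := @unif_points _ _ R N v.
Let T := (rc_T M0 * borel_rV R n.+1)%type.
Let P : probability T R := (rc_P M0 \x Q)%E.

Let Wf (z : T) : borel_rV R n := rc_W M0 z.1.
Let Af (z : T) : borel_rV R n.+1 := z.2.

Let mW : measurable_fun [set: T] Wf.
Proof. exact: measurableT_comp (measurable_funP (rc_W M0)) measurable_fst. Qed.

Let mA : measurable_fun [set: T] Af.
Proof. exact: measurable_snd. Qed.

HB.instance Definition _ := isMeasurableFun.Build _ _ _ _ Wf mW.
HB.instance Definition _ := isMeasurableFun.Build _ _ _ _ Af mA.

Let W : {RV P >-> borel_rV R n} := Wf.
Let A : {RV P >-> borel_rV R n.+1} := Af.

Let P_rect B C : measurable B -> measurable C ->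
  P (W @^-1` B `&` A @^-1` C) = (rc_P M0 (rc_W M0 @^-1` B) * Q C)%E.
Proof.
move=> mB mC.
have -> : W @^-1` B `&` A @^-1` C = (rc_W M0 @^-1` B) `*` C by [].
apply: product_measure1E => //.
by rewrite -[_ @^-1` _]setTI; exact: measurable_funP.
Qed.

Let law_W B : measurable B -> P (W @^-1` B) = rc_P M0 (rc_W M0 @^-1` B).
Proof.
move=> mB; rewrite -[W @^-1` B]setIT -(preimage_setT A) P_rect//.
by rewrite probability_setT mule1.
Qed.

Let law_A C : measurable C -> P (A @^-1` C) = Q C.
Proof.
move=> mC; rewrite -[A @^-1` C]setTI -(preimage_setT W) P_rect//.
by rewrite preimage_setT probability_setT mul1e.
Qed.

Let AW_indep : independent_RV A W.
Proof. by move=> B C mB mC; rewrite setIC P_rect// law_W// law_A// muleC. Qed.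

Let ge0_integral_A (f : borel_rV R n.+1 -> \bar R) :
    measurable_fun [set: _] f -> (forall x, 0 <= f x)%E ->
  (\int[P]_z f (A z) = \int[Q]_x f x)%E.
Proof.
move=> mf f0; rewrite -[LHS](@ge0_integral_distribution _ _ _ _ _ P A f)//.
by apply: eq_measure_integral => S mS _; exact: law_A.
Qed.

Let integral_A (f : borel_rV R n.+1 -> R) : measurable_fun [set: _] f ->
  (\int[P]_z (f (A z))%:E = (N.+1%:R^-1 * \sum_(k < N.+1) f (v k))%:E)%E.
Proof.
move=> mf; rewrite -(integral_unif_points N v mf).
have mEf : measurable_fun [set: _] (EFin \o f) by exact/measurable_EFinP.
rewrite -[LHS](@integral_distribution _ _ _ _ _ P A (EFin \o f))//.
  by apply: eq_measure_integral => S mS _; exact: law_A.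
apply/integrableP; split; first exact: measurableT_comp.
have mab : measurable_fun [set: _] (abse \o (EFin \o f)).
  exact: measurableT_comp.
have ab0 x : (0 <= (abse \o (EFin \o f)) x)%E by exact: abse_ge0.
rewrite (ge0_integral_A mab ab0) (ge0_integral_unif_points N v mab ab0).
by rewrite lte_sum_pinfty// => k _; rewrite lte_mul_pinfty//= ltry.
Qed.

Let A_L2 (i : 'I_n.+1) : (fun t => (A t : 'rV[R]_n.+1) 0 i) \in Lfun P 2%:E.
Proof.
rewrite inE; apply/andP; split; rewrite inE/=.
  exact: measurableT_comp (measurable_coord i) mA.
rewrite /finite_norm unlock/= poweR_lty//.
pose F (x : borel_rV R n.+1) : \bar R := (`|(x : 'rV[R]_n.+1) 0 i| `^ 2)%:E.
have mF : measurable_fun [set: _] F.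
  apply/measurable_EFinP.
  apply: (measurableT_comp (measurable_powR 2)).
  apply: measurableT_comp => //; exact: measurable_coord.
rewrite (_ : (\int[_]_x _ = \int[P]_z F (A z))%E)//.
have F0 x : (0 <= F x)%E by rewrite lee_fin powR_ge0.
rewrite (ge0_integral_A mF F0) (ge0_integral_unif_points N v mF F0).
by rewrite lte_sum_pinfty// => k _; rewrite lte_mul_pinfty//= ltry.
Qed.

(** On the product of the space of [M0] with the space of the noise, the
    coefficients are independent of the covariates and the law of the covariates
    is that of [M0]. *)
Definition noise_model : rc_model R n := RCModel A_L2 AW_indep.

Lemma noise_model_law : same_covariate_law noise_model M0.
Proof. by move=> B mB; exact: law_W. Qed.

Lemma mean_vec_noise_model i :
  mean_vec noise_model 0 i =
    N.+1%:R^-1 * \sum_(k < N.+1) (v k : 'rV[R]_n.+1) 0 i.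
Proof. by rewrite mxE unlock (integral_A (measurable_coord i)). Qed.

Lemma cov_mx_noise_model i j :
    \sum_(k < N.+1) (v k : 'rV[R]_n.+1) = 0 ->
  cov_mx noise_model i j = N.+1%:R^-1 *
    \sum_(k < N.+1) (v k : 'rV[R]_n.+1) 0 i * (v k : 'rV[R]_n.+1) 0 j.
Proof.
move=> v0; have mean0 l : mean_vec noise_model 0 l = 0.
  by rewrite mean_vec_noise_model -summxE v0 mxE mulr0.
rewrite cov_mxE unlock/= (integral_A (measurable_centered_prod noise_model (i, j))).
congr (_ * _); apply: eq_bigr => k _.
by rewrite /centered_prod !mean0 !subr0.
Qed.

End NoiseModel.

(** Two models with the same mean are told apart through the conditional
    variance only, that is through the values of their covariance forms on the
    support. *)
Lemma not_identified_of_pair (R : realType) n (M0 M M' : rc_model R n) :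
    same_covariate_law M M0 -> same_covariate_law M' M0 ->
    posdef (cov_mx M) -> posdef (cov_mx M') ->
    mean_vec M = mean_vec M' ->
    (forall w, suppW M0 w -> qform (cov_mx M) (with_intercept w) =
                             qform (cov_mx M') (with_intercept w)) ->
    cov_mx M != cov_mx M' ->
  ~ identified_full_rank M0.
Proof.
move=> law law' pd pd' mm qq /eqP cc id; apply: cc.
have [|//] := id _ _ law law' pd pd'.
move=> w Sw; have SM : suppW M w by rewrite (suppW_same_law law).
have SM' : suppW M' w by rewrite (suppW_same_law law').
rewrite (cond_mean_response SM) (cond_mean_response SM').
by rewrite (cond_var_response SM) (cond_var_response SM') /mean_form mm qq.
Qed.

Section SpikedModel.
Context (R : realType) (n : nat).
Implicit Types (M : rc_model R n) (u : 'rV[R]_n.+1).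

(** The points [+- sqrt m x], for the [m = n + 2] vectors [x] of [spike_axes u],
    form a centred family with second moment matrix the sum of the [x^T x],
    which is [1 + u^T u]. *)
Definition spike_axes u : seq 'rV[R]_n.+1 :=
  u :: [seq delta_mx 0 i | i <- enum 'I_n.+1].

Definition spike_half u : seq 'rV[R]_n.+1 :=
  [seq Num.sqrt n.+2%:R *: x | x <- spike_axes u].

Definition spike_points u : seq 'rV[R]_n.+1 :=
  spike_half u ++ [seq - x | x <- spike_half u].

Lemma size_spike_points u : size (spike_points u) = (n.+2 + n.+1).+1.
Proof.
by rewrite size_cat !size_map /= size_map size_enum_ord addnS.
Qed.

Definition spiked_model M u : rc_model R n :=
  noise_model M (n.+2 + n.+1) (nth 0 (spike_points u)).

(** The points come in opposite pairs. *)
Lemma sum_spike_points (V : nmodType) u (F : 'rV[R]_n.+1 -> V) :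
  \sum_(k < (n.+2 + n.+1).+1) F (spike_points u)`_k =
  \sum_(x <- spike_half u) (F x + F (- x)).
Proof.
rewrite -(big_mkord xpredT (fun k => F (spike_points u)`_k)).
rewrite -(size_spike_points u) -(big_nth 0 xpredT F).
by rewrite big_cat big_split; congr (_ + _); rewrite big_map.
Qed.

Lemma sum_spike_points0 u :
  \sum_(k < (n.+2 + n.+1).+1) (spike_points u)`_k = 0 :> 'rV[R]_n.+1.
Proof.
by rewrite (sum_spike_points u id) big1// => x _; rewrite subrr.
Qed.

Lemma mean_vec_spiked M u : mean_vec (spiked_model M u) = 0.
Proof.
apply/rowP => i; rewrite mean_vec_noise_model -summxE sum_spike_points0.
by rewrite !mxE mulr0.
Qed.

Lemma cov_mx_spiked M u : cov_mx (spiked_model M u) = 1%:M + u^T *m u.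
Proof.
apply/matrixP => i j; rewrite cov_mx_noise_model ?sum_spike_points0//.
rewrite (sum_spike_points u (fun x => x 0 i * x 0 j)).
transitivity (\sum_(x <- spike_axes u) x 0 i * x 0 j).
  have m0 : (n.+2%:R : R) != 0 by rewrite pnatr_eq0.
  rewrite big_map mulr_sumr; apply: eq_bigr => x _; rewrite !mxE.
  have -> : ((n.+2 + n.+1).+1%:R : R) = 2 * n.+2%:R.
    by rewrite -addnS natrD mulr_natl mulr2n.
  rewrite mulrNN -mulr2n mulrACA -expr2 sqr_sqrtr ?ler0n// -[_ *+ 2]mulr_natl.
  by move: (n.+2%:R : R) m0 => m m0; field.
rewrite /spike_axes big_cons big_map big_enum/= !mxE big_ord1 !mxE addrC.
congr (_ + _); rewrite (bigD1 i)//= big1 => [|k ki].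
  by rewrite !mxE !eqxx/= mul1r addr0 eq_sym.
by rewrite !mxE eq_sym (negPf ki) mul0r.
Qed.

Lemma qform_spiked u x : qform (1%:M + u^T *m u) x =
  \sum_i x 0 i ^+ 2 + (\sum_i u 0 i * x 0 i) ^+ 2.
Proof.
rewrite /qform mulmxDr mulmx1 mulmxDl mxE; congr (_ + _).
  by rewrite mxE; apply: eq_bigr => i _; rewrite mxE expr2.
rewrite mulmxA -mulmxA mxE big_ord1 expr2; congr (_ * _).
  by rewrite mxE; apply: eq_bigr => i _; rewrite mxE mulrC.
by rewrite mxE; apply: eq_bigr => i _; rewrite mxE.
Qed.

Lemma posdef_spiked u : posdef (1%:M + u^T *m u).
Proof.
split; first by rewrite linearD/= trmx1 trmx_mul trmxK.
move=> x x0; rewrite -/(qform _ x) qform_spiked.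
rewrite ltr_wpDr ?sqr_ge0// lt0r sumr_ge0 ?andbT => [|i _]; last exact: sqr_ge0.
apply: contra x0 => /eqP x2; apply/eqP/rowP => i; rewrite mxE.
apply/eqP; rewrite -sqrf_eq0 eq_le sqr_ge0 andbT -x2 (bigD1 i)//= lerDl.
by apply: sumr_ge0 => k _; exact: sqr_ge0.
Qed.

(** The spiked models of [u] and [v] have the same mean and nonsingular
    covariances that differ by [u^T u - v^T v], whose quadratic form
    [(u . x)^2 - (v . x)^2] vanishes at the points [x = (1, w)] of interest. *)
Lemma spiked_not_identified M (u v : 'rV[R]_n.+1) :
    u^T *m u != v^T *m v ->
    (forall w, suppW M w -> (\sum_i u 0 i * with_intercept w 0 i) ^+ 2 =
                             (\sum_i v 0 i * with_intercept w 0 i) ^+ 2) ->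
  ~ identified_full_rank M.
Proof.
move=> uv Suv.
apply: (@not_identified_of_pair _ _ M (spiked_model M u) (spiked_model M v)).
- exact: noise_model_law.
- exact: noise_model_law.
- by rewrite cov_mx_spiked; exact: posdef_spiked.
- by rewrite cov_mx_spiked; exact: posdef_spiked.
- by rewrite !mean_vec_spiked.
- by move=> w Sw; rewrite !cov_mx_spiked !qform_spiked Suv.
- by rewrite !cov_mx_spiked (inj_eq (addrI _)).
Qed.

End SpikedModel.
(** * Rank, identification and its failure *)

(** A closed set that carries [W_j] pulls back to a closed set that carries [W]. *)
Lemma suppW_suppWj (R : realType) n (M : rc_model R n) w j :
  suppW M w -> suppWj M j (w 0 j).
Proof.
move=> Sw C [[cC PC] _]; apply: (Sw [set w : 'rV[R]_n | C (w 0 j)]).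
split=> //; split=> //.
apply: (preimage_closed (f := fun w : 'rV[R]_n => w 0 j)) cC.
by move=> x _; exact: coord_continuous.
Qed.

Theorem theorem4 (R : realType) (n : nat) (hp : (2 <= n.+1)%N)
    (M : rc_model R n) :
  ((exists T : 'I_n -> set R,
      (forall j : 'I_n, (T j #= `I_3)%card) /\
      (forall w : 'rV[R]_n, (forall j : 'I_n, T j (w 0 j)) -> suppW M w)) ->
    (exists w : 'I_((n.+1 * n.+2)./2) -> 'rV[R]_n,
      (forall k, suppW M (w k)) /\
      \rank (design_mx w) = (n.+1 * n.+2)./2) /\
    identified M) /\
  ((exists j : 'I_n, (suppWj M j #= `I_2)%card) -> ~ identified_full_rank M).
Proof.
split=> [[T [T3 TS]]|[j S2]].
  have [t tI tT] := card_grid T3.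
  have tS (k : 'I_n -> 'I_3) : suppW M (\row_j t j (k j)).
    by apply: TS => j; rewrite mxE.
  split; last exact: identified_grid tI tS.
  have [w wr] := grid_rank tI.
  by exists (fun l => \row_j t j (w l j)); split=> // l; exact: tS.
have /eq_cardSP[a Sa /eq_cardSP[b [Sb _] S0]] := S2.
have Sab x : suppWj M j x -> x = a \/ x = b.
  move=> Sx; apply: contrapT => /not_orP[xa xb].
  move: S0; rewrite II0 card_eq0 => /eqP S0.
  by have : set0 x by rewrite -S0.
(* (u . (1, w))^2 - (v . (1, w))^2 = (w_j - a) (w_j - b). *)
pose u : 'rV[R]_n.+1 :=
  delta_mx 0 (lift ord0 j) - ((a + b) / 2) *: delta_mx 0 ord0.
pose v : 'rV[R]_n.+1 := ((a - b) / 2) *: delta_mx 0 ord0.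
have dot i x : \sum_l (delta_mx 0 i : 'rV[R]_n.+1) 0 l * x l = x i.
  rewrite (bigD1 i)//= big1 => [|l li]; first by rewrite mxE !eqxx mul1r addr0.
  by rewrite mxE (negPf li) andbF mul0r.
apply: (@spiked_not_identified _ _ _ u v).
  apply/eqP => /matrixP/(_ (lift ord0 j) (lift ord0 j)).
  rewrite !mxE !big_ord1 !mxE !eqxx/= !mulr0 subr0 mulr1 => /eqP.
  by rewrite oner_eq0.
move=> w Sw; have wab := Sab _ (@suppW_suppWj _ _ _ _ j Sw).
have -> : \sum_i u 0 i * with_intercept w 0 i = w 0 j - (a + b) / 2.
  transitivity (\sum_i (
      (delta_mx 0 (lift ord0 j) : 'rV[R]_n.+1) 0 i * with_intercept w 0 i -
      (a + b) / 2 *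
        ((delta_mx 0 ord0 : 'rV[R]_n.+1) 0 i * with_intercept w 0 i))).
    by apply: eq_bigr => i _; rewrite mxsubE scalemxE mulrBl mulrA.
  by rewrite sumrB -mulr_sumr !dot with_interceptS with_intercept0 mulr1.
have -> : \sum_i v 0 i * with_intercept w 0 i = (a - b) / 2.
  under eq_bigr do rewrite scalemxE -mulrA.
  by rewrite -mulr_sumr dot with_intercept0 mulr1.
by case: wab => ->; field.
Qed.
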